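(* Let $\mathrm{pen}$ be a real-valued polyhedral gauge on $\mathbb{R}^p$, $X\in\mathbb{R}^{n\times p}$ and $\beta\in\mathbb{R}^p$. Let $y^{(r)} = X\beta + \varepsilon^{(r)}$, where $(\varepsilon^{(r)})_{r\in\mathbb{N}}$ is a sequence in $\mathbb{R}^n$ with $\lim_{r\to\infty}\varepsilon^{(r)} = 0$. Assume that uniform uniqueness holds, i.e. $S_{X,\lambda\mathrm{pen}}(y)$ is a singleton for all $y\in\mathbb{R}^n$ and all $\lambda>0$. Let $(\lambda^{(r)})_{r\in\mathbb{N}}$ be a sequence of positive numbers with $\lim_{r\to\infty}\lambda^{(r)} = 0$ and let $\hat\beta^{(r)}$ be the unique element of $S_{X,\lambda^{(r)}\mathrm{pen}}(y^{(r)})$. If the pattern of $\beta$ is accessible with respect to $X$ and $\mathrm{pen}$, then there exists $r_0\in\mathbb{N}$ such that for all $r\ge r_0$ $$\partial_{\mathrm{pen}}(\hat\beta^{(r)}) \subseteq \partial_{\mathrm{pen}}(\beta).$$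
   Context: A prime denotes transpose. A real-valued polyhedral gauge on $\mathbb{R}^p$ is a function of the form $\mathrm{pen}(b) = \max\{u_1'b,\dots,u_k'b\}$ for some $u_1,\dots,u_k \in \mathbb{R}^p$ with $u_1 = 0$; $\partial_{\mathrm{pen}}(\beta)$ is its subdifferential at $\beta$. For $y\in\mathbb{R}^n$ and $\lambda>0$ let $S_{X,\lambda\mathrm{pen}}(y) = \mathrm{Arg}\min_{b\in\mathbb{R}^p} \frac12\|y-Xb\|_2^2 + \lambda\,\mathrm{pen}(b)$. The pattern of $\beta$ is accessible with respect to $X$ and $\lambda\,\mathrm{pen}$ if there exist $y\in\mathbb{R}^n$ and $\hat\beta \in S_{X,\lambda\mathrm{pen}}(y)$ with $\partial_{\mathrm{pen}}(\hat\beta) = \partial_{\mathrm{pen}}(\beta)$; this does not depend on the value of $\lambda>0$, so one says ''accessible with respect to $X$ and $\mathrm{pen}$''. *)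

(* Defs.v *)
From HB Require Import structures.
From mathcomp Require Import all_boot all_order all_algebra.
From mathcomp Require Import all_classical all_reals all_analysis.
Set Implicit Arguments.
Unset Strict Implicit.
Unset Printing Implicit Defensive.
Import Order.TTheory GRing.Theory Num.Theory.
Import numFieldNormedType.Exports.
Local Open Scope classical_set_scope.
Local Open Scope ring_scope.

Definition dot (R : realType) (m : nat) (u v : 'cV[R]_m) : R :=
  (u^T *m v) 0 0.

(* The Euclidean norm; the norm `|v| of the library is the sup norm. *)
Definition norm2 (R : realType) (m : nat) (v : 'cV[R]_m) : R :=
  Num.sqrt (\sum_(i < m) v i 0 ^+ 2).

(* The default value of the big maximum is itself a member of the nonempty
   family, so this is the maximum of the family and nothing more. *)
Definition polyhedral_gauge (R : realType) (p : nat)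
    (pen : 'cV[R]_p -> R) : Prop :=
  exists (k : nat) (u : 'I_k.+1 -> 'cV[R]_p),
    u ord0 = 0 /\
    forall b, pen b = \big[Num.max/dot (u ord0) b]_(i < k.+1) dot (u i) b.

Definition subdifferential (R : realType) (p : nat)
    (f : 'cV[R]_p -> R) (x : 'cV[R]_p) : set 'cV[R]_p :=
  [set s | forall z, f x + dot s (z - x) <= f z].

Definition objective (R : realType) (n p : nat) (X : 'M[R]_(n, p))
    (lambda : R) (pen : 'cV[R]_p -> R) (y : 'cV[R]_n) (b : 'cV[R]_p) : R :=
  2^-1 * norm2 (y - X *m b) ^+ 2 + lambda * pen b.

Definition minimizers (R : realType) (n p : nat) (X : 'M[R]_(n, p))
    (lambda : R) (pen : 'cV[R]_p -> R) (y : 'cV[R]_n) : set 'cV[R]_p :=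
  [set b | forall c, objective X lambda pen y b <= objective X lambda pen y c].

Definition accessible_at (R : realType) (n p : nat) (X : 'M[R]_(n, p))
    (lambda : R) (pen : 'cV[R]_p -> R) (beta : 'cV[R]_p) : Prop :=
  exists (y : 'cV[R]_n) (b : 'cV[R]_p),
    minimizers X lambda pen y b /\
    subdifferential pen b = subdifferential pen beta.

(* [accessible_at] does not depend on lambda > 0 when pen is convex: replace y
   by X b + (lambda' / lambda) (y - X b).  Asking for some lambda > 0 is
   therefore the same as asking for all of them. *)
Definition accessible (R : realType) (n p : nat) (X : 'M[R]_(n, p))
    (pen : 'cV[R]_p -> R) (beta : 'cV[R]_p) : Prop :=
  exists lambda : R, 0 < lambda /\ accessible_at X lambda pen beta.

Definition uniform_uniqueness (R : realType) (n p : nat) (X : 'M[R]_(n, p))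
    (pen : 'cV[R]_p -> R) : Prop :=
  forall (y : 'cV[R]_n) (lambda : R), 0 < lambda ->
    exists b : 'cV[R]_p, minimizers X lambda pen y = [set b].

(* Main.v *)
Require Import Defs.
From HB Require Import structures.
From mathcomp Require Import all_boot all_order all_algebra.
From mathcomp Require Import all_classical all_reals all_analysis.
From mathcomp Require Import ring lra.
Set Implicit Arguments.
Unset Strict Implicit.
Unset Printing Implicit Defensive.
Import Order.TTheory GRing.Theory Num.Theory.
Import numFieldNormedType.Exports.
Local Open Scope classical_set_scope.
Local Open Scope ring_scope.

(** The proof combines a local property of the penalty with a convergence
    result.

    Local property.  Along a short segment starting at [beta], a maximum of
    finitely many linear forms is affine, because only the forms active at
    [beta] compete.  A subgradient [s] at a point [b] near [beta] must have
    the slope of [pen] in the direction [b - beta], so its affine minorant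
    also touches [pen] at [beta]: [s] is a subgradient at [beta].  This is
    [subdifferential_locally_decreasing]; it reduces the theorem to the
    convergence of the estimators to [beta], which is [minimizers_cvg].

    Convergence.  Fermat's rule turns accessibility into the existence of a
    subgradient [s = X^T z] of [pen] at [beta].  Let
    [D h = pen (beta + h) - pen beta - s.h], which is nonnegative.  If
    [X h = 0] and [D h = 0], then [beta] and [beta + h] both minimize the
    objective for the response [X beta + z] and the tuning parameter 1, so
    uniqueness forces [h = 0].  Hence [F h = D h + |X h|^2] is positive off
    the origin, and being convex it is bounded away from 0 outside every ball
    around the origin: it suffices to show that [F] tends to 0 along the
    errors [h_r].

    Comparing the objective at the estimator and at [beta] gives
    [|X h_r|^2 <= 4 |eps_r|^2 + 4 lambda_r pen beta], which tends to 0.  The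
    same comparison bounds [D h_r] only by a multiple of
    [|eps_r - lambda_r z|^2 / lambda_r], which need not tend to 0, since no
    rate relates [eps_r] to [lambda_r].  Instead, an estimator has the least
    penalty among all vectors with the same fit, and one such vector depends
    linearly, hence continuously, on the fit: [beta + P X h_r] with [P] a
    generalized inverse of [X].  So [D h_r] is at most a continuous function
    of [X h_r] that vanishes at 0. *)

(** * The Euclidean inner product *)

Section Dot.
Context {R : realType}.

Lemma dotE m (u v : 'cV[R]_m) : dot u v = \sum_i u i 0 * v i 0.
Proof. by rewrite /dot !mxE; apply: eq_bigr => i _; rewrite !mxE. Qed.

Lemma dotC m (u v : 'cV[R]_m) : dot u v = dot v u.
Proof. by rewrite !dotE; apply: eq_bigr => i _; rewrite mulrC. Qed.

Lemma dotDr m (u v w : 'cV[R]_m) : dot u (v + w) = dot u v + dot u w.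
Proof. by rewrite /dot mulmxDr mxE. Qed.

Lemma dotNr m (u v : 'cV[R]_m) : dot u (- v) = - dot u v.
Proof. by rewrite /dot mulmxN mxE. Qed.

Lemma dotBr m (u v w : 'cV[R]_m) : dot u (v - w) = dot u v - dot u w.
Proof. by rewrite dotDr dotNr. Qed.

Lemma dotZr m a (u v : 'cV[R]_m) : dot u (a *: v) = a * dot u v.
Proof. by rewrite /dot -scalemxAr mxE. Qed.

Lemma dotDl m (u v w : 'cV[R]_m) : dot (v + w) u = dot v u + dot w u.
Proof. by rewrite !(dotC _ u) dotDr. Qed.

Lemma dotNl m (u v : 'cV[R]_m) : dot (- v) u = - dot v u.
Proof. by rewrite !(dotC _ u) dotNr. Qed.

Lemma dotZl m a (u v : 'cV[R]_m) : dot (a *: v) u = a * dot v u.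
Proof. by rewrite !(dotC _ u) dotZr. Qed.

Lemma dot0r m (u : 'cV[R]_m) : dot u 0 = 0.
Proof. by rewrite /dot mulmx0 mxE. Qed.

Lemma dot0l m (u : 'cV[R]_m) : dot 0 u = 0.
Proof. by rewrite dotC dot0r. Qed.

Definition dot_lin := (dotDr, dotDl, dotNr, dotNl, dotZr, dotZl).

Lemma dot_mulmxr m p (X : 'M[R]_(m, p)) u v : dot u (X *m v) = dot (X^T *m u) v.
Proof. by rewrite /dot trmx_mul trmxK mulmxA. Qed.

Lemma dot_ge0 m (v : 'cV[R]_m) : 0 <= dot v v.
Proof. by rewrite dotE; apply: sumr_ge0 => i _; rewrite -expr2 sqr_ge0. Qed.

Lemma dot_eq0 m (v : 'cV[R]_m) : dot v v = 0 -> v = 0.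
Proof.
rewrite dotE => /eqP; rewrite psumr_eq0; last first.
  by move=> i _; rewrite -expr2 sqr_ge0.
move=> /allP v0; apply/matrixP => i j; rewrite ord1 mxE; apply/eqP.
by have := v0 i (mem_index_enum _); rewrite /= mulf_eq0 orbb.
Qed.

Lemma sqr_coord_le_dot m (v : 'cV[R]_m) i : v i 0 ^+ 2 <= dot v v.
Proof.
rewrite dotE (bigD1 i) //= -expr2 lerDl.
by apply: sumr_ge0 => j _; rewrite -expr2 sqr_ge0.
Qed.

Lemma norm2_sqr m (v : 'cV[R]_m) : norm2 v ^+ 2 = dot v v.
Proof.
rewrite sqr_sqrtr; first by rewrite dotE; apply: eq_bigr => i _; rewrite expr2.
by apply: sumr_ge0 => i _; exact: sqr_ge0.
Qed.

End Dot.

(** * Topology of matrix spaces *)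

Section MatrixTopology.
Context {R : realType}.

Lemma cvg_mx {T : Type} {F : set_system T} {FF : Filter F} m n
    (f : T -> 'M[R]_(m, n)) (l : 'M[R]_(m, n)) :
  (forall i j, f x i j @[x --> F] --> l i j) -> f x @[x --> F] --> l.
Proof.
move=> fl; apply/cvg_ballP => e e0.
have : \forall x \near F, forall i j, ball (l i j) e (f x i j).
  apply: filter_forall => i; apply: filter_forall => j.
  by have /cvg_ballP := fl i j; apply.
by apply: filterS => x flx; split.
Qed.

Lemma mulmx_continuous m n p (A : 'M[R]_(m, n)) :
  continuous (fun B : 'M[R]_(n, p) => A *m B).
Proof.
move=> B; apply: (@cvg_mx _ (nbhs B) _) => i j; rewrite mxE.
under eq_cvg do rewrite mxE.
apply: cvg_big => [|k _]; first exact: add_continuous.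
by apply: cvgM; [exact: cvg_cst|exact: coord_continuous].
Qed.

Lemma trmx_continuous m n : continuous (@trmx R m n).
Proof.
move=> B; apply: (@cvg_mx _ (nbhs B) _) => i j; rewrite mxE.
by under eq_cvg do rewrite mxE; exact: coord_continuous.
Qed.

Lemma dot_cvg {T : Type} {F : set_system T} {FF : Filter F} m
    (f g : T -> 'cV[R]_m) (a b : 'cV[R]_m) :
  f x @[x --> F] --> a -> g x @[x --> F] --> b ->
  dot (f x) (g x) @[x --> F] --> dot a b.
Proof.
move=> fa gb; rewrite dotE; under eq_cvg do rewrite dotE.
apply: cvg_big => [|k _]; first exact: add_continuous.
apply: cvgM.
  exact: (cvg_comp _ _ fa (@coord_continuous _ _ _ k 0 a)).
exact: (cvg_comp _ _ gb (@coord_continuous _ _ _ k 0 b)).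
Qed.

Lemma dot_continuous m (u : 'cV[R]_m) : continuous (dot u).
Proof.
by move=> v; apply: (@dot_cvg _ (nbhs v) _); [exact: cvg_cst|exact: cvg_id].
Qed.

Lemma dot_cvg0 {T : Type} {F : set_system T} {FF : Filter F} m
    (f : T -> 'cV[R]_m) :
  dot (f x) (f x) @[x --> F] --> 0 -> f x @[x --> F] --> (0 : 'cV[R]_m).
Proof.
move=> f0; apply: cvg_mx => i j; rewrite ord1 mxE; apply/cvgr0Pnorm_lt => e e0.
have e20 : 0 < e ^+ 2 by rewrite exprn_gt0.
move/cvgr0Pnorm_lt : f0 => /(_ _ e20); apply: filterS => x.
rewrite ger0_norm ?dot_ge0 // => fe.
rewrite -(ltr_pXn2r (ltn0Sn 1)) ?nnegrE ?normr_ge0 ?ltW //.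
by rewrite -normrX ger0_norm ?sqr_ge0 // (le_lt_trans (sqr_coord_le_dot _ _)).
Qed.

Lemma sphere_compact p (d : R) : compact [set h : 'cV[R]_p | `|h| = d].
Proof.
(* The sphere is closed in a cube, and a cube of column vectors is the
   transpose of a product of segments. *)
pose Q := [set v : 'rV[R]_p | forall i, `[- d, d]%classic (v 0 i)].
have cQ : compact (@trmx R 1 p @` Q).
  apply: continuous_compact.
    by apply: continuous_subspaceT; exact: trmx_continuous.
  by apply: (@rV_compact _ _ (fun=> `[- d, d]%classic)) => _; exact: segment_compact.
apply: (subclosed_compact _ cQ).
  have := @norm_continuous R 'cV[R]_p.
  move=> /continuous_closedP /(_ [set d]); apply.
  exact: closed_eq.
move=> h /= hd; exists h^T; last by rewrite trmxK.
move=> i /=; rewrite in_itv /= -ler_norml mxE -hd.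
rewrite [leRHS]/Num.norm /= mx_normrE.
exact: (le_bigmax _ (fun ij : 'I_p * 'I_1 => `|h ij.1 ij.2|) (i, 0)).
Qed.

End MatrixTopology.

(** * Polyhedral gauges *)

Section Gauge.
Context {R : realType}.

Definition convex_fun p (f : 'cV[R]_p -> R) : Prop :=
  forall (b c : 'cV[R]_p) (t : R), 0 <= t -> t <= 1 ->
    f (b + t *: (c - b)) <= f b + t * (f c - f b).

Lemma gauge_ge_dot p k (u : 'I_k.+1 -> 'cV[R]_p) pen :
  (forall b, pen b = \big[Num.max/dot (u ord0) b]_(i < k.+1) dot (u i) b) ->
  forall b i, dot (u i) b <= pen b.
Proof. by move=> penE b i; rewrite penE; exact: (le_bigmax _ (fun j => dot (u j) b)). Qed.

Lemma gauge_le p k (u : 'I_k.+1 -> 'cV[R]_p) pen :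
  (forall b, pen b = \big[Num.max/dot (u ord0) b]_(i < k.+1) dot (u i) b) ->
  forall b c, (forall i, dot (u i) b <= c) -> pen b <= c.
Proof. by move=> penE b c ubc; rewrite penE; apply: bigmax_le => [|i _]. Qed.

Lemma gauge_ge0 p (pen : 'cV[R]_p -> R) b : polyhedral_gauge pen -> 0 <= pen b.
Proof.
by move=> [k [u [u0 penE]]]; rewrite -(dot0l b) -u0; exact: (gauge_ge_dot penE).
Qed.

Lemma gauge_convex p (pen : 'cV[R]_p -> R) :
  polyhedral_gauge pen -> convex_fun pen.
Proof.
move=> [k [u [u0 penE]]] b c t t0 t1; apply: (gauge_le penE) => i.
have := gauge_ge_dot penE b i; have := gauge_ge_dot penE c i.
rewrite dotDr dotZr dotBr; nra.
Qed.

Lemma gauge_continuous p (pen : 'cV[R]_p -> R) :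
  polyhedral_gauge pen -> continuous pen.
Proof.
move=> [k [u [u0 penE]]].
have -> : pen = fun b => \big[Num.max/0]_(i < k.+1) dot (u i) b.
  by apply/funext => b; rewrite penE u0 dot0l.
apply: continuous_big => [|i _]; last exact: dot_continuous.
exact: max_continuous.
Qed.

(** Both sides agree at [beta].  A form active at [beta] satisfies the bound
    everywhere; an inactive one satisfies it strictly at [beta], hence nearby.
    By convexity the inequality says that [pen] is affine on the segment from
    [beta] to its reflection through [b]. *)
Lemma gauge_near_linear p (pen : 'cV[R]_p -> R) (beta : 'cV[R]_p) :
  polyhedral_gauge pen ->
  \forall b \near beta, pen (beta + 2 *: (b - beta)) <= 2 * pen b - pen beta.
Proof.
move=> gpen; have cpen := gauge_continuous gpen.
case: gpen => k [u [u0 penE]].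
suff H : \forall b \near beta, forall i,
    dot (u i) (beta + 2 *: (b - beta)) <= 2 * pen b - pen beta.
  by apply: filterS H => b Hb; exact: (gauge_le penE).
apply: (@filter_forall _ _ _ (nbhs beta) _) => i.
have := gauge_ge_dot penE beta i; rewrite le_eqVlt => /orP[/eqP ubeta|ubeta].
  near=> b; have := gauge_ge_dot penE b i.
  rewrite dotDr dotZr dotBr ubeta; lra.
pose g b := 2 * pen b - 2 * dot (u i) b.
have cg : g b @[b --> beta] --> g beta.
  apply: (@cvgB _ _ _ (nbhs beta) _); apply: (@cvgM _ _ (nbhs beta) _);
    try exact: cvg_cst.
  - exact: cpen.
  - exact: dot_continuous.
have gbeta : pen beta - dot (u i) beta < g beta by rewrite /g; lra.
apply: filterS (cvgr_gt (g beta) cg _ gbeta) => b.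
rewrite /g dotDr dotZr dotBr; lra.
Unshelve. all: by end_near. Qed.

(** A subgradient at [b] is pinned to the slope of [pen] along [b - beta], so
    moving its point of contact back from [b] to [beta] costs nothing. *)
Lemma subdifferential_locally_decreasing p (pen : 'cV[R]_p -> R) (beta : 'cV[R]_p) :
  polyhedral_gauge pen ->
  \forall b \near beta, subdifferential pen b `<=` subdifferential pen beta.
Proof.
(* The subgradient inequality at [beta] and at its reflection through [b]
   bound [s.(b - beta)] from both sides by [pen b - pen beta]. *)
move=> gpen; apply: filterS (gauge_near_linear beta gpen) => b Hb s sb z.
have := sb z; have := sb beta; have := sb (beta + 2 *: (b - beta)).
rewrite !dot_lin; lra.
Qed.

End Gauge.

(** * Minimizers of the penalized least squares objective *)

Section Minimizers.
Context {R : realType}.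

(** The objective at [c] exceeds its value at [b] by [lambda] times the gap in
    the subgradient inequality plus a square of second order in [c - b].  For
    necessity, if the gap were negative, it would dominate the square on a
    short enough segment towards [c]. *)
Lemma minimizers_fermat n p (X : 'M[R]_(n, p)) (pen : 'cV[R]_p -> R) lambda y b :
  convex_fun pen -> 0 < lambda ->
  minimizers X lambda pen y b <->
  subdifferential pen b (lambda^-1 *: (X^T *m (y - X *m b))).
Proof.
move=> pen_convex l0.
have expand c : objective X lambda pen y c = objective X lambda pen y b
    + lambda * (pen c - pen b - dot (lambda^-1 *: (X^T *m (y - X *m b))) (c - b))
    + 2^-1 * dot (X *m (c - b)) (X *m (c - b)).
  rewrite /objective !norm2_sqr dotZl -dot_mulmxr mulmxBr !dot_lin.
  rewrite !(dotC _ y) (dotC (X *m c) (X *m b)).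
  by field; rewrite gt_eqF.
split=> [bmin c|bsub c].
  set s := _ *: _; set q := dot (X *m (c - b)) (X *m (c - b)).
  have q0 : 0 <= q by exact: dot_ge0.
  suff : 0 <= pen c - pen b - dot s (c - b) by lra.
  rewrite leNgt; apply/negP => Dlt0.
  set D' := pen c - pen b - dot s (c - b) in Dlt0.
  have t_opt t : 0 < t -> t <= 1 -> 0 <= lambda * D' + 2^-1 * t * q.
    move=> t0 t1; have := bmin (b + t *: (c - b)).
    rewrite (expand (b + t *: (c - b))).
    have -> : b + t *: (c - b) - b = t *: (c - b) by rewrite addrC addKr.
    rewrite -/s -!scalemxAr !dotZr [in dot (t *: _) _]dotZl -/q.
    have := pen_convex b c t (ltW t0) t1.
    set P := pen _ => HP H.
    rewrite -(pmulr_rge0 _ t0).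
    have : lambda * (P - pen b - t * dot s (c - b)) <= lambda * (t * D').
      by rewrite ler_pM2l // /D'; lra.
    by lra.
  (* The step [t] is small enough for [lambda * D' + t * (q + 1) <= 0]; the
     [+ 1] keeps the quotient meaningful when [q = 0]. *)
  pose t := Num.min 1 (- (lambda * D') / (q + 1)).
  have lD : 0 < - (lambda * D') by rewrite -mulrN mulr_gt0 // oppr_gt0.
  have q1 : 0 < q + 1 by lra.
  have t0 : 0 < t by rewrite lt_min ltr01 divr_gt0.
  have t1 : t <= 1 by rewrite ge_min lexx.
  have tq : t * (q + 1) <= - (lambda * D').
    by rewrite -ler_pdivlMr // ge_min lexx orbT.
  have := t_opt t t0 t1; nra.
rewrite (expand c) -addrA lerDl addr_ge0 //.
  by rewrite mulr_ge0 ?(ltW l0) // -addrA -opprD subr_ge0; exact: bsub.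
by rewrite mulr_ge0 ?dot_ge0 // invr_ge0.
Qed.

(** By Fermat's rule the residual at a minimizer, divided by the tuning
    parameter, is such a [z]. *)
Lemma accessible_row_subgradient n p (X : 'M[R]_(n, p)) pen beta :
  convex_fun pen -> accessible X pen beta ->
  exists z, subdifferential pen beta (X^T *m z).
Proof.
move=> pen_convex [l [l0 [y [b [/(minimizers_fermat _ _ _ pen_convex l0) bsub]]]]].
by move=> <-; exists (l^-1 *: (y - X *m b)); rewrite -scalemxAr.
Qed.

(** For the response [X *m beta + z], the residual is [z] at [beta] as well as
    at [beta + h], and [X^T *m z] is a subgradient at both points; so both are
    minimizers. *)
Lemma uniqueness_transversal n p (X : 'M[R]_(n, p)) pen beta z h :
  convex_fun pen -> uniform_uniqueness X pen ->
  subdifferential pen beta (X^T *m z) ->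
  X *m h = 0 -> pen (beta + h) <= pen beta -> h = 0.
Proof.
move=> pen_convex huniq bsub Xh0 pen_le.
have sh0 : dot (X^T *m z) h = 0 by rewrite -dot_mulmxr Xh0 dot0r.
have [b0 bE] := huniq (X *m beta + z) 1 ltr01.
have : minimizers X 1 pen (X *m beta + z) beta.
  by apply/minimizers_fermat => //; rewrite invr1 scale1r addrC addKr.
have : minimizers X 1 pen (X *m beta + z) (beta + h).
  apply/minimizers_fermat => //.
  rewrite invr1 scale1r [X *m (_ + h)]mulmxDr Xh0 addr0 [_ + z]addrC addrK => c.
  have := bsub c; rewrite !dot_lin sh0; lra.
rewrite bE => /= bh bb; apply: (@addrI _ beta).
by rewrite addr0 bh bb.
Qed.

(** The cross term [eps.(X (b - beta))] is absorbed by expanding the square of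
    [X (b - beta) / 2 - eps]. *)
Lemma minimizers_sqr_fit_le n p (X : 'M[R]_(n, p)) pen beta b eps lambda :
  (forall c, 0 <= pen c) -> 0 < lambda ->
  minimizers X lambda pen (X *m beta + eps) b ->
  dot (X *m (b - beta)) (X *m (b - beta))
    <= 4 * dot eps eps + 4 * (lambda * pen beta).
Proof.
move=> pen0 l0 /(_ beta); rewrite /objective !norm2_sqr.
set w := X *m (b - beta).
have -> : X *m beta + eps - X *m b = eps - w.
  by rewrite /w mulmxBr opprB addrCA addrA addrC addrA addrC; congr (_ + _).
rewrite [_ + eps]addrC addrK.
have := mulr_ge0 (ltW l0) (pen0 b).
have := dot_ge0 (2^-1 *: w - eps).
rewrite !dot_lin (dotC w eps); lra.
Qed.

(** This is what makes the consistency of the estimators independent of how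
    fast the tuning parameters vanish: [lambda] has dropped out of the
    conclusion. *)
Lemma minimizers_same_fit n p (X : 'M[R]_(n, p)) pen lambda y b c :
  0 < lambda -> minimizers X lambda pen y b -> X *m c = X *m b -> pen b <= pen c.
Proof.
move=> l0 /(_ c); rewrite /objective => /[swap] ->.
by rewrite lerD2l ler_pM2l.
Qed.

End Minimizers.

(** * Convergence of the estimators *)

Section Consistency.
Context {R : realType}.

(** By compactness [F] has a positive minimum on the sphere of radius [d], and
    the last hypothesis, which convexity and [F 0 = 0] imply, makes [F] grow
    along rays. *)
Lemma starshaped_coercive p (F : 'cV[R]_p -> R) (d : R) :
  0 < d -> continuous F -> (forall h, h != 0 -> 0 < F h) ->
  (forall h t, 0 <= t -> t <= 1 -> F (t *: h) <= t * F h) ->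
  exists2 m, 0 < m & forall h, d <= `|h| -> m <= F h.
Proof.
move=> d0 cF F_gt0 Fstar; pose S := [set h : 'cV[R]_p | `|h| = d].
have toS h : d <= `|h| -> S ((d / `|h|) *: h).
  move=> dh; have h0 : 0 < `|h| by exact: lt_le_trans dh.
  by rewrite /S /= normrZ ger0_norm ?divr_ge0 ?ltW // divfK ?gt_eqF.
(* The sphere is empty in dimension 0. *)
have [S0|/set0P/negP/negPn/eqP S0] := pselect (S !=set0); last first.
  by exists 1 => // h /toS; rewrite S0.
have [c /set_mem cS cmin] := compact_EVT_min S0 (@sphere_compact R p d)
  (continuous_subspaceT cF).
have c0 : c != 0 by rewrite -normr_gt0 cS.
exists (F c); first exact: F_gt0.
move=> h dh; have h0 : 0 < `|h| by exact: lt_le_trans dh.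
have t0 : 0 <= d / `|h| by rewrite divr_ge0 ?ltW.
have t1 : d / `|h| <= 1 by rewrite ler_pdivrMr ?mul1r.
apply: (le_trans (cmin _ (mem_set (toS h dh)))).
apply: (le_trans (Fstar _ _ t0 t1)).
by rewrite ler_piMl // ltW // F_gt0 // -normr_gt0.
Qed.

Lemma minimizers_cvg n p (pen : 'cV[R]_p -> R) (X : 'M[R]_(n, p))
    (beta : 'cV[R]_p) (eps : nat -> 'cV[R]_n) (lambda : nat -> R)
    (b : nat -> 'cV[R]_p) :
  polyhedral_gauge pen -> uniform_uniqueness X pen -> accessible X pen beta ->
  eps r @[r --> \oo] --> (0 : 'cV[R]_n) ->
  (forall r, 0 < lambda r) -> lambda r @[r --> \oo] --> (0 : R) ->
  (forall r, minimizers X (lambda r) pen (X *m beta + eps r) (b r)) ->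
  b r @[r --> \oo] --> beta.
Proof.
move=> gpen huniq hacc eps0 l_gt0 l0 bmin.
have pen_convex := gauge_convex gpen.
have pen_cont := gauge_continuous gpen.
have [z zsub] := accessible_row_subgradient pen_convex hacc.
pose s := X^T *m z.
pose q (h : 'cV[R]_p) := dot (X *m h) (X *m h).
pose F (h : 'cV[R]_p) := pen (beta + h) - pen beta - dot s h + q h.
have D_ge0 h : 0 <= pen (beta + h) - pen beta - dot s h.
  by have := zsub (beta + h); rewrite [beta + h - _]addrC addKr -/s; lra.
have shift_cvg (T : topologicalType) (f : T -> 'cV[R]_p) x : {for x, continuous f} ->
    pen (beta + f t) @[t --> x] --> pen (beta + f x).
  move=> fx; apply: (cvg_comp (fun t => beta + f t) pen); last exact: pen_cont.
  by apply: (@cvgD _ _ _ (nbhs x) _) => //; exact: cvg_cst.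
have F_cont : continuous F.
  move=> h; apply: (@cvgD _ _ _ (nbhs h) _); last first.
    by apply: (@dot_cvg _ _ (nbhs h) _); exact: mulmx_continuous.
  apply: (@cvgB _ _ _ (nbhs h) _); last exact: dot_continuous.
  apply: (@cvgB _ _ _ (nbhs h) _); last exact: cvg_cst.
  exact: (shift_cvg _ id).
have F_gt0 h : h != 0 -> 0 < F h.
  move=> h0; rewrite lt_neqAle addr_ge0 ?D_ge0 ?dot_ge0 // andbT eq_sym.
  apply: contra h0 => /eqP Fh0; apply/eqP.
  have Dh := D_ge0 h; have qh : 0 <= q h by exact: dot_ge0.
  have Xh0 : X *m h = 0 by apply: dot_eq0; move: Fh0; rewrite /F -/(q h); lra.
  apply: (uniqueness_transversal pen_convex huniq zsub) => //.
  have sh0 : dot s h = 0 by rewrite -dot_mulmxr Xh0 dot0r.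
  by move: Fh0; rewrite /F sh0; lra.
have F_star h t : 0 <= t -> t <= 1 -> F (t *: h) <= t * F h.
  move=> t0 t1; rewrite /F /q -scalemxAr !dotZr dotZl -/(q h).
  have := pen_convex beta (beta + h) t t0 t1.
  rewrite [beta + h - _]addrC addKr.
  have : t * (t * q h) <= t * q h.
    by rewrite ler_wpM2l // ler_piMl // dot_ge0.
  lra.
(* [beta + pinvmx X *m w] has the fit [X *m beta + w] when [w] is in the range
   of [X]; [G w] is then the value of [D] at [pinvmx X *m w]. *)
pose G w := pen (beta + pinvmx X *m w) - pen beta - dot z w.
have G0 : G 0 = 0 by rewrite /G mulmx0 addr0 dot0r; lra.
have G_cont : continuous G.
  move=> w; apply: (@cvgB _ _ _ (nbhs w) _); last exact: dot_continuous.
  apply: (@cvgB _ _ _ (nbhs w) _); last exact: cvg_cst.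
  by apply: shift_cvg; exact: mulmx_continuous.
have F_le_G r : F (b r - beta) <= G (X *m (b r - beta)) + q (b r - beta).
  rewrite lerD2r /G dot_mulmxr lerD2r lerD2r addrC subrK.
  apply: (minimizers_same_fit (l_gt0 r) (bmin r)).
  rewrite [X *m (beta + _)]mulmxDr (mulmxA X (pinvmx X)).
  rewrite mulmxA mulmxKpV ?submx_refl //.
  by rewrite mulmxBr addrC subrK.
have q_cvg : q (b r - beta) @[r --> \oo] --> 0.
  apply: (@squeeze_cvgr _ _ _ _ (fun=> 0)
    (fun r => 4 * dot (eps r) (eps r) + 4 * (lambda r * pen beta))).
  - apply: nearW => r; rewrite dot_ge0 /=.
    by apply: minimizers_sqr_fit_le => // c; exact: gauge_ge0.
  - exact: cvg_cst.
  - have -> : 0 = 4 * dot (0 : 'cV[R]_n) 0 + 4 * (0 * pen beta) :> R.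
      by rewrite dot0r mul0r !mulr0 addr0.
    apply: cvgD; (apply: cvgM; first exact: cvg_cst); first exact: dot_cvg.
    by apply: cvgM => //; exact: cvg_cst.
have Xb_cvg : X *m (b r - beta) @[r --> \oo] --> (0 : 'cV[R]_n).
  exact: dot_cvg0 q_cvg.
have GF_cvg : G (X *m (b r - beta)) + q (b r - beta) @[r --> \oo] --> 0.
  rewrite -[X in _ --> X]addr0 -[X in _ --> X + _]G0; apply: cvgD => //.
  exact: (cvg_comp (fun r => X *m (b r - beta)) G Xb_cvg (G_cont 0)).
apply/cvgrPdist_lt => d d0.
have [m m0 Fm] := starshaped_coercive d0 F_cont F_gt0 F_star.
apply: filterS (cvgr_lt _ GF_cvg _ m0) => r GFm.
rewrite distrC ltNge; apply/negP => /Fm; apply/negP; rewrite -ltNge.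
exact: le_lt_trans (F_le_G r) GFm.
Qed.

End Consistency.

(** * Inclusion of the patterns *)

Theorem theorem5p1 (R : realType) (n p : nat) (pen : 'cV[R]_p -> R)
  (X : 'M[R]_(n, p)) (beta : 'cV[R]_p)
  (eps y : nat -> 'cV[R]_n) (lambda : nat -> R) (betahat : nat -> 'cV[R]_p)
  (hpen : polyhedral_gauge pen)
  (hy : forall r, y r = X *m beta + eps r)
  (heps : eps r @[r --> \oo] --> (0 : 'cV[R]_n))
  (huniq : uniform_uniqueness X pen)
  (hlambda_gt0 : forall r, 0 < lambda r)
  (hlambda : lambda r @[r --> \oo] --> (0 : R))
  (hbetahat : forall r, minimizers X (lambda r) pen (y r) (betahat r))
  (hacc : accessible X pen beta) :
  exists r0 : nat, forall r : nat, (r0 <= r)%N ->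
    subdifferential pen (betahat r) `<=` subdifferential pen beta.
Proof.
have bmin r : minimizers X (lambda r) pen (X *m beta + eps r) (betahat r).
  by rewrite -hy.
have b_cvg := minimizers_cvg hpen huniq hacc heps hlambda_gt0 hlambda bmin.
have [r0 _ Hr0] := b_cvg _ (subdifferential_locally_decreasing beta hpen).
by exists r0 => r r0r; exact: Hr0.
Qed.
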